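(* Let $H=H(t,q,p)$ be a smooth current value Hamiltonian (partial Hamiltonian) in the variables $t$, $q=(q^1,\dots,q^n)$, $p=(p_1,\dots,p_n)$, with associated system $$\dot q^i=\frac{\partial H}{\partial p_i},\qquad \dot p_i=-\frac{\partial H}{\partial q^i}+\Gamma_i,\qquad i=1,\dots,n, \qquad (\ast)$$ where each $\Gamma_i=\Gamma_i(t,q,p)$ is a nonzero smooth function. Let $$X=\xi(t,q,p)\frac{\partial}{\partial t}+\eta^i(t,q,p)\frac{\partial}{\partial q^i}+\zeta_i(t,q,p)\frac{\partial}{\partial p_i}$$ be an operator with smooth coefficients and let $B=B(t,q,p)$ be a smooth function. Then $X$ is a partial Hamiltonian operator of $H$ corresponding to the system $(\ast)$, with gauge function $B$, if and only if $$I=p_i\eta^i-\xi H-B$$ is a first integral of the system $(\ast)$.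
   Context: The summation convention over repeated indices $i=1,\dots,n$ is used. $D$ denotes the total derivative operator with respect to $t$, $$D=\frac{\partial}{\partial t}+\dot q^i\frac{\partial}{\partial q^i}+\dot p_i\frac{\partial}{\partial p_i}+\cdots .$$ On solutions of the system $(\ast)$, $\dot q^i$ and $\dot p_i$ are replaced by the right-hand sides of $(\ast)$, so that for a function $F(t,q,p)$ one has $D(F)=\frac{\partial F}{\partial t}+\frac{\partial H}{\partial p_i}\frac{\partial F}{\partial q^i}+\left(-\frac{\partial H}{\partial q^i}+\Gamma_i\right)\frac{\partial F}{\partial p_i}$. First integral: a function $I(t,q,p)$ is a first integral of $(\ast)$ if $D(I)=0$ on the solutions of $(\ast)$. Partial Hamiltonian operator: an operator $X=\xi\,\partial/\partial t+\eta^i\,\partial/\partial q^i+\zeta_i\,\partial/\partial p_i$, with $\xi,\eta^i,\zeta_i$ functions of $(t,q,p)$, is a partial Hamiltonian operator corresponding to the current value Hamiltonian $H$ of the system $(\ast)$ if there exists a function $B(t,q,p)$ (called the gauge function) such that $$\zeta_i\frac{\partial H}{\partial p_i}+p_iD(\eta^i)-X(H)-H\,D(\xi)=D(B)+\left(\eta^i-\xi\frac{\partial H}{\partial p_i}\right)(-\Gamma_i)$$ holds on the solutions of $(\ast)$. Saying that $X$ is a partial Hamiltonian operator with gauge function $B$ means that this identity holds with that $B$. Here $X(H)=\xi\frac{\partial H}{\partial t}+\eta^i\frac{\partial H}{\partial q^i}+\zeta_i\frac{\partial H}{\partial p_i}$. *)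

(* Defs.v *)
(* MathComp-Analysis *)
From mathcomp Require Import all_boot all_order all_algebra.
From mathcomp Require Import all_classical all_reals all_analysis.

Set Implicit Arguments.
Unset Strict Implicit.
Unset Printing Implicit Defensive.
Import Order.TTheory GRing.Theory Num.Theory.
Import numFieldNormedType.Exports.
Local Open Scope classical_set_scope.
Local Open Scope ring_scope.

(* Points are triples (t, q, p). *)
Notation phase R n := (R * 'rV[R]_n * 'rV[R]_n)%type.

(* Every iterated directional derivative of F is (Frechet) differentiable at
   every point of U.  For U open this is C^infinity on U, and the values of F
   outside U are irrelevant. *)
Definition smooth_on (R : realType) (V : normedModType R) (U : set V)
    (F : V -> R) : Prop :=
  forall (vs : seq V) (x : V), U x ->
    differentiable (foldr (fun v (G : V -> R) => 'D_v G) F vs) x.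

Section PartialHamiltonian.
Variables (R : realType) (n : nat).
Local Notation V := (phase R n).
Implicit Types (F H B : V -> R) (Gamma : 'I_n -> V -> R) (U : set V).
Implicit Types (x : V) (qd pd : 'rV[R]_n) (i : 'I_n).

Definition p_ i x : R := x.2 0 i.

Definition partial_t F x : R := 'D_((1, 0, 0) : V) F x.
Definition partial_q i F x : R := 'D_((0, delta_mx 0 i, 0) : V) F x.
Definition partial_p i F x : R := 'D_((0, 0, delta_mx 0 i) : V) F x.

(* The total derivative lives on the jet space: qd and pd are independent
   variables standing for dq/dt and dp/dt.  No higher-order terms of D occur,
   since F depends on (t, q, p) only. *)
Definition totalD F x qd pd : R :=
  partial_t F x + \sum_(i < n) qd 0 i * partial_q i F x
                + \sum_(i < n) pd 0 i * partial_p i F x.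

Definition system H Gamma x qd pd : Prop :=
  forall i, qd 0 i = partial_p i H x
         /\ pd 0 i = - partial_q i H x + Gamma i x.

(* An identity between functions on the jet space holds on the solutions of
   the system when it holds after the substitution of the right-hand sides
   of the system for qd and pd. *)
Definition on_solutions U H Gamma (P : V -> 'rV[R]_n -> 'rV[R]_n -> Prop)
    : Prop :=
  forall x qd pd, U x -> system H Gamma x qd pd -> P x qd pd.

Definition first_integral U H Gamma F : Prop :=
  on_solutions U H Gamma (fun x qd pd => totalD F x qd pd = 0).

(* xi d/dt + eta^i d/dq^i + zeta_i d/dp_i *)
Record operator := Operator {
  xi : V -> R;
  eta : 'I_n -> V -> R;
  zeta : 'I_n -> V -> R }.

Definition smooth_operator U (X : operator) : Prop :=
  [/\ smooth_on U (xi X),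
      forall i, smooth_on U (eta X i)
    & forall i, smooth_on U (zeta X i)].

Definition apply_op (X : operator) F x : R :=
  xi X x * partial_t F x + \sum_(i < n) eta X i x * partial_q i F x
                         + \sum_(i < n) zeta X i x * partial_p i F x.

Definition partial_Hamiltonian_operator_with_gauge U H Gamma (X : operator) B
    : Prop :=
  on_solutions U H Gamma (fun x qd pd =>
    \sum_(i < n) zeta X i x * partial_p i H x
      + \sum_(i < n) p_ i x * totalD (eta X i) x qd pd
      - apply_op X H x - H x * totalD (xi X) x qd pd
    = totalD B x qd pd
      + \sum_(i < n) (eta X i x - xi X x * partial_p i H x) * - Gamma i x).

End PartialHamiltonian.

(* Main.v *)
From HB Require Import structures.
Require Import Defs.
From mathcomp Require Import all_boot all_order all_algebra.
From mathcomp Require Import all_classical all_reals all_analysis.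
From mathcomp Require Import ring.
Import Order.TTheory GRing.Theory Num.Theory.
Import numFieldNormedType.Exports.
Local Open Scope classical_set_scope.
Local Open Scope ring_scope.

(** On solutions, the defining identity of a partial Hamiltonian operator and
    the equation D(I) = 0 are the same scalar equation at every point of the
    phase space, so neither direction needs an integration argument.

    Since I depends on (t, q, p) only, D(I) is the directional derivative of I
    along (1, dq/dt, dp/dt) ([totalD_derive]); the Leibniz rule therefore
    applies to D, and as D(p_i) = dp_i/dt it gives ([totalD_integral])
      D(I) = eta^i dp_i/dt + p_i D(eta^i) - xi D(H) - H D(xi) - D(B).
    On solutions dp_i/dt = - dH/dq^i + Gamma_i, and in D(H) the two products
    of first derivatives of H cancel, which leaves
    D(H) = dH/dt + Gamma_i dH/dp_i ([totalD_hamiltonian]).  After these two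
    substitutions D(I) is the left-hand side of the operator identity minus
    its right-hand side: the terms zeta_i dH/dp_i cancel against those
    in X(H), and the terms in Gamma_i are those of the right-hand side
    ([operator_defect]). *)

Section TotalDerivative.
Context {R : realType} {n : nat}.
Local Notation V := (phase R n).
Implicit Types (F H B : V -> R) (x w : V) (qd pd : 'rV[R]_n).

Lemma velocity_decomposition qd pd :
  (1, qd, pd) = (1, 0, 0) + \sum_(i < n) qd 0 i *: (0, delta_mx 0 i, 0)
                + \sum_(i < n) pd 0 i *: (0, 0, delta_mx 0 i) :> V.
Proof.
have Eq : \sum_(i < n) qd 0 i *: ((0, delta_mx 0 i, 0) : V) = (0, qd, 0).
  rewrite [in RHS](row_sum_delta qd).
  apply: (big_rec2 (fun (a : V) b => a = (0, b, 0))) => [//|i _ v _ ->].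
  by congr (_, _, _); rewrite /= ?scaler0 ?addr0.
have Ep : \sum_(i < n) pd 0 i *: ((0, 0, delta_mx 0 i) : V) = (0, 0, pd).
  rewrite [in RHS](row_sum_delta pd).
  apply: (big_rec2 (fun (a : V) b => a = (0, 0, b))) => [//|i _ v _ ->].
  by congr (_, _, _); rewrite /= ?scaler0 ?addr0.
by rewrite Eq Ep; congr (_, _, _); rewrite /= ?addr0 ?add0r.
Qed.

(** [totalD] is given in coordinates; in this form it inherits the calculus
    rules of directional derivatives.  Differentiability is what makes the
    directional derivative additive in the direction. *)
Lemma totalD_derive F x qd pd : differentiable F x ->
  totalD F x qd pd = 'D_((1, qd, pd) : V) F x.
Proof.
move=> dF; rewrite [RHS]deriveE// velocity_decomposition !raddfD !raddf_sum /=.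
rewrite /totalD /partial_t /partial_q /partial_p !deriveE//.
by congr (_ + _ + _); apply: eq_bigr => i _; rewrite !deriveE// linearZ.
Qed.

Fact p_is_linear (i : 'I_n) : linear (@p_ R n i).
Proof. by move=> a u v; rewrite /p_ !mxE. Qed.

HB.instance Definition _ (i : 'I_n) :=
  GRing.isLinear.Build R V R *:%R (@p_ R n i) (p_is_linear i).

Lemma continuous_p (i : 'I_n) : continuous (@p_ R n i).
Proof.
move=> x.
apply: (@continuous_comp _ _ _ snd (fun M : 'rV[R]_n => M 0 i)).
  exact: cvg_snd.
exact: coord_continuous.
Qed.

Lemma differentiable_p (i : 'I_n) x : differentiable (@p_ R n i) x.
Proof. exact/linear_differentiable/continuous_p. Qed.

Lemma derive_p (i : 'I_n) x w : 'D_w (@p_ R n i) x = w.2 0 i.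
Proof.
by rewrite deriveE ?diff_lin//; [exact: continuous_p|exact: differentiable_p].
Qed.

Lemma totalD_integral (eta : 'I_n -> V -> R) (xi : V -> R) H B x qd pd :
  (forall i, differentiable (eta i) x) -> differentiable xi x ->
  differentiable H x -> differentiable B x ->
  totalD (fun y => \sum_(i < n) p_ i y * eta i y - xi y * H y - B y) x qd pd
  = \sum_(i < n) eta i x * pd 0 i + \sum_(i < n) p_ i x * totalD (eta i) x qd pd
    - xi x * totalD H x qd pd - H x * totalD xi x qd pd - totalD B x qd pd.
Proof.
move=> de dxi dH dB.
have dpe i : differentiable (@p_ R n i * eta i) x.
  by apply: differentiableM => //; exact: differentiable_p.
have dS := differentiable_sum dpe.
have dxH : differentiable (xi * H) x by exact: differentiableM.
have dSx : differentiable (\sum_(i < n) (@p_ R n i * eta i) - xi * H) x.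
  exact: differentiableB.
rewrite [X in totalD X](_ : _ = \sum_(i < n) (@p_ R n i * eta i) - xi * H - B).
  rewrite !totalD_derive//; last exact: differentiableB.
  do 2![rewrite deriveB; [|exact: diff_derivable..]].
  rewrite derive_sum; last by move=> i; exact: diff_derivable.
  rewrite deriveM; [|exact: diff_derivable..].
  rewrite opprD addrA; congr (_ - _ - _ - _).
  rewrite -big_split; apply: eq_bigr => i _ /=.
  rewrite deriveM ?derive_p; try exact: diff_derivable.
    by rewrite addrC totalD_derive.
  exact/diff_derivable/differentiable_p.
by apply/funext => y; rewrite !fctE fct_sumE.
Qed.

(** The Hamiltonian part of the velocity contributes the Poisson bracket of [H]
    with itself, which vanishes; what remains is the explicit dependence on
    time and the power of the forces [Gamma], as [partial_p i H] is the
    velocity of q^i. *)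
Lemma totalD_hamiltonian H Gamma x qd pd : system H Gamma x qd pd ->
  totalD H x qd pd
  = partial_t H x + \sum_(i < n) Gamma i x * partial_p i H x.
Proof.
move=> sys; rewrite /totalD -addrA -big_split; congr (_ + _).
by apply: eq_bigr => i _ /=; have [-> ->] := sys i; ring.
Qed.

(** An exact formula for the defect of the operator identity, rather than one
    implication: both directions of the equivalence follow from it. *)
Lemma operator_defect H Gamma (X : operator R n) B x qd pd :
  system H Gamma x qd pd ->
  (forall i, differentiable (eta X i) x) -> differentiable (xi X) x ->
  differentiable H x -> differentiable B x ->
  totalD (fun y => \sum_(i < n) p_ i y * eta X i y - xi X y * H y - B y)
    x qd pd
  = \sum_(i < n) zeta X i x * partial_p i H x
      + \sum_(i < n) p_ i x * totalD (eta X i) x qd pd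
      - apply_op X H x - H x * totalD (xi X) x qd pd
    - (totalD B x qd pd
       + \sum_(i < n) (eta X i x - xi X x * partial_p i H x) * - Gamma i x).
Proof.
move=> sys de dxi dH dB.
rewrite totalD_integral// (totalD_hamiltonian _ _ _ _ _ sys) /apply_op.
have -> : \sum_(i < n) eta X i x * pd 0 i =
    \sum_(i < n) eta X i x * Gamma i x
    - \sum_(i < n) eta X i x * partial_q i H x.
  rewrite -sumrB; apply: eq_bigr => i _.
  by have [_ ->] := sys i; ring.
have -> : \sum_(i < n) (eta X i x - xi X x * partial_p i H x) * - Gamma i x =
    xi X x * (\sum_(i < n) Gamma i x * partial_p i H x)
    - \sum_(i < n) eta X i x * Gamma i x.
  by rewrite mulr_sumr -sumrB; apply: eq_bigr => i _; ring.
ring.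
Qed.

End TotalDerivative.

Lemma smooth_on_differentiable {R : realType} {V : normedModType R} (U : set V)
  (F : V -> R) x : smooth_on U F -> U x -> differentiable F x.
Proof. by move=> /(_ [::] x). Qed.

Theorem theorem3 (R : realType) (n : nat) (U : set (phase R n))
    (H : phase R n -> R) (Gamma : 'I_n -> phase R n -> R)
    (X : operator R n) (B : phase R n -> R) :
  open U ->
  smooth_on U H ->
  (forall i : 'I_n, smooth_on U (Gamma i)) ->
  (forall i : 'I_n, exists2 x, U x & Gamma i x != 0) ->
  smooth_operator U X ->
  smooth_on U B ->
  partial_Hamiltonian_operator_with_gauge U H Gamma X B <->
  first_integral U H Gamma
    (fun x => \sum_(i < n) p_ i x * eta X i x - xi X x * H x - B x).
Proof.
move=> _ sH _ _ [sxi seta _] sB.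
have defect x qd pd : U x -> system H Gamma x qd pd -> _ :=
  fun Ux sys => operator_defect _ _ _ _ _ _ _ sys
    (fun i => smooth_on_differentiable _ _ _ (seta i) Ux)
    (smooth_on_differentiable _ _ _ sxi Ux)
    (smooth_on_differentiable _ _ _ sH Ux)
    (smooth_on_differentiable _ _ _ sB Ux).
split=> hyp x qd pd Ux sys.
  by rewrite defect// (hyp _ _ _ Ux sys) subrr.
by apply/eqP; rewrite -subr_eq0 -defect//; apply/eqP; exact: hyp.
Qed.
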